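(* Let $\mathcal V\subset\mathscr V$ be a set of value functions, $\mathcal W\subset\mathscr W$ a set of weighting functions, and let $\xi\in\mathcal L^0(\mathbb R)$. Assume that $\sup_{(v,w^-,w^+)\in\mathcal V\times\mathcal W\times\mathcal W}\mathbb E_{w^-w^+}[v(\xi-x)]$ is well-defined for every $x\in\mathbb R$. Define $$\rho_{\mathcal V\times\mathcal W}(\xi):=\inf\Big\{x\in\mathbb R:\ \sup_{(v,w^-,w^+)\in\mathcal V\times\mathcal W\times\mathcal W}\mathbb E_{w^-w^+}[v(\xi-x)]\le 0\Big\},$$ $$\Pi_{\mathcal V\times\mathcal W}(\xi):=\sup_{(v,w^-,w^+)\in\mathcal V\times\mathcal W\times\mathcal W}\rho_{(v,w^-,w^+)}(\xi),\qquad \rho_{(v,w^-,w^+)}(\xi):=\inf\{x\in\mathbb R:\ \mathbb E_{w^-w^+}[v(\xi-x)]\le 0\}.$$ Then $$\rho_{\mathcal V\times\mathcal W}(\xi)=\Pi_{\mathcal V\times\mathcal W}(\xi).$$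
   Context: $(\Omega,\mathcal F,\mathbb P)$ is a probability space and $\mathcal L^0(\mathbb R)$ is the space of real-valued random variables on it. $\mathscr V$ is the set of all value functions $v:\mathbb R\to\mathbb R$ that are strictly increasing with $v(0)=0$. $\mathscr W$ is the set of all weighting functions $w:[0,1]\to[0,1]$ that are strictly increasing with $w(0)=0$, $w(1)=1$. For $v\in\mathscr V$, $w^-,w^+\in\mathscr W$ and a random variable $\zeta$, $$\mathbb E_{w^-w^+}[v(\zeta)]=\int_0^\infty w^+(\mathbb P(v(\zeta)\ge t))\,dt-\int_{-\infty}^0 w^-(\mathbb P(v(\zeta)\le t))\,dt.$$ The infimum over the empty set is $+\infty$. *)

(* Defs.v *)
From HB Require Import structures.
From mathcomp Require Import all_boot all_order all_algebra.
From mathcomp Require Import all_classical all_reals all_analysis.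

Set Implicit Arguments.
Unset Strict Implicit.
Unset Printing Implicit Defensive.

Import Order.TTheory GRing.Theory Num.Theory.
Import numFieldNormedType.Exports.

Local Open Scope classical_set_scope.
Local Open Scope ring_scope.

Definition value_functions (R : realType) : set (R -> R) :=
  [set v | {homo v : x y / x < y} /\ v 0 = 0].

(* A weighting function [0,1] -> [0,1] is represented by a function R -> R
   constrained only on [0,1]; its values elsewhere are never used, since it is
   only ever applied to probabilities. *)
Definition weighting_functions (R : realType) : set (R -> R) :=
  [set w | [/\ {in `[0, 1]%R, forall p, w p \in `[0, 1]%R},
               {in `[0, 1]%R &, {homo w : p q / p < q}},
               w 0 = 0 & w 1 = 1]].

Section WeightedExpectation.
Context d (T : measurableType d) (R : realType) (P : probability T R).
Implicit Types (v wm wp : R -> R) (zeta xi : T -> R).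
(* (v, w^-, w^+) *)
Implicit Types (theta : (R -> R) * (R -> R) * (R -> R)).
Implicit Types (V W : set (R -> R)).

Local Open Scope ereal_scope.

Definition gain_part wp v zeta : \bar R :=
  \int[lebesgue_measure]_(t in `[0%R, +oo[)
    (wp (fine (P [set omega | (t <= v (zeta omega))%R])))%:E.

Definition loss_part wm v zeta : \bar R :=
  \int[lebesgue_measure]_(t in `]-oo, 0%R])
    (wm (fine (P [set omega | (v (zeta omega) <= t)%R])))%:E.

Definition weighted_expectation theta zeta : \bar R :=
  let: (v, wm, wp) := theta in gain_part wp v zeta - loss_part wm v zeta.

(* The difference is not of the form +oo - +oo; infinite values are allowed. *)
Definition weighted_expectation_defined theta zeta : bool :=
  let: (v, wm, wp) := theta in gain_part wp v zeta +? - loss_part wm v zeta.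

Definition sup_weighted_expectation V W zeta : \bar R :=
  ereal_sup [set weighted_expectation theta zeta | theta in V `*` W `*` W].

Definition sup_weighted_expectation_defined V W zeta : Prop :=
  forall theta, (V `*` W `*` W) theta ->
    weighted_expectation_defined theta zeta.

(* rho_{V x W}; ereal_inf set0 = +oo. *)
Definition robust_shortfall V W xi : \bar R :=
  ereal_inf [set x%:E | x in
    [set x : R | sup_weighted_expectation V W (xi \- cst x)%R <= 0]].

(* rho_{(v, w^-, w^+)} *)
Definition shortfall theta xi : \bar R :=
  ereal_inf [set x%:E | x in
    [set x : R | weighted_expectation theta (xi \- cst x)%R <= 0]].

(* Pi_{V x W} *)
Definition sup_shortfall V W xi : \bar R :=
  ereal_sup [set shortfall theta xi | theta in V `*` W `*` W].

End WeightedExpectation.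

(* Main.v *)
(** Since value and weighting functions are increasing, [E_theta[v(xi - x)]] is
    nonincreasing in [x], so each set [A_theta = {x | E_theta[v(xi - x)] <= 0}]
    is an up-set of the real line. The robust acceptance set is the
    intersection of the [A_theta], and for up-sets the infimum of an
    intersection is the supremum of the infima. *)

Require Import Defs.
From HB Require Import structures.
From mathcomp Require Import all_boot all_order all_algebra.
From mathcomp Require Import all_classical all_reals all_analysis.
From mathcomp Require Import measurable_realfun.

Set Implicit Arguments.
Unset Strict Implicit.
Unset Printing Implicit Defensive.

Import Order.TTheory GRing.Theory Num.Theory.
Import numFieldNormedType.Exports.

Local Open Scope classical_set_scope.
Local Open Scope ring_scope.

(** The bound from below is inclusion of the intersection in each [A i]. Conversely, a real [r]
    strictly above the supremum exceeds every infimum, so each [A i] has a point below [r] and,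
    being an up-set, contains [r]. *)
Lemma ereal_inf_bigcap_up (R : realType) I (D : set I) (A : I -> set R)
  (upA : forall i, D i -> forall x y, x <= y -> A i x -> A i y) :
  ereal_inf [set x%:E | x in \bigcap_(i in D) A i] =
  ereal_sup [set ereal_inf [set x%:E | x in A i] | i in D].
Proof.
apply/eqP; rewrite eq_le; apply/andP; split; last first.
  apply: ge_ereal_sup => _ [i Di <-].
  by apply: ereal_inf_le_tmp => _ [x Ax <-]; exists x => //; exact: Ax.
set s := ereal_sup _.
have inf_le r : (s < r%:E)%E ->
    (ereal_inf [set x%:E | x in \bigcap_(i in D) A i] <= r%:E)%E.
  move=> sr; apply: ereal_inf_lbound; exists r => // i Di.
  have : (ereal_inf [set x%:E | x in A i] < r%:E)%E.
    by apply: le_lt_trans sr; apply: ereal_sup_ubound; exists i.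
  move=> /ereal_inf_lt[_ [x Aix <-]]; rewrite lte_fin => xr.
  exact: upA _ Di _ _ (ltW xr) Aix.
case: s inf_le => [s||] inf_le; last 2 first.
- exact: leey.
(* For [s] equal to -oo, as when [D] is empty, every real bounds the infimum from above: [r - 1]
   rules out a finite value [r], and [0] rules out +oo. *)
- case: (ereal_inf _) inf_le => [r||] inf_le //.
    by have := inf_le (r - 1) (ltNyr _); rewrite lee_fin leNgt ltrBlDr ltrDl ltr01.
  by have := inf_le 0 (ltNyr _).
- by apply/lee_addgt0Pr => e e0; apply: inf_le; rewrite lte_fin ltrDl.
Qed.

Section Monotonicity.
Context d (T : measurableType d) (R : realType) (P : probability T R).
Implicit Types (v w wm wp : R -> R) (zeta : T -> R).

Lemma weighting_homo_le w : @weighting_functions R w ->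
  {in `[0, 1] &, {homo w : p q / p <= q}}.
Proof.
move=> [_ wlt _ _] p q p01 q01; rewrite le_eqVlt => /predU1P[->//|pq].
exact/ltW/wlt.
Qed.

Lemma value_homo_le v : @value_functions R v -> {homo v : x y / x <= y}.
Proof.
by move=> [vlt _] x y; rewrite le_eqVlt => /predU1P[->//|/vlt/ltW].
Qed.

(** Monotonicity alone makes [v] Borel; it may have jumps. *)
Lemma measurable_value_comp v (f : T -> R) : @value_functions R v ->
  measurable_fun setT f -> measurable_fun setT (v \o f).
Proof.
move=> /value_homo_le v_le; apply: measurableT_comp.
exact: nondecreasing_measurable.
Qed.

(** Weighting functions are constrained only on [0,1], so this gives access to their properties. *)
Lemma fine_probability_itv (A : set T) : measurable A ->
  fine (P A) \in `[0, 1].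
Proof.
move=> mA; rewrite in_itv/= fine_ge0//= -lee_fin fineK ?fin_num_measure//.
exact: probability_le1.
Qed.

Lemma weighted_probability_ge0 w (A : set T) : @weighting_functions R w ->
  measurable A -> 0 <= w (fine (P A)).
Proof.
move=> [w01 _ _ _] /fine_probability_itv/w01.
by rewrite in_itv/= => /andP[].
Qed.

Lemma weighted_probability_le w (A B : set T) : @weighting_functions R w ->
  measurable A -> measurable B -> A `<=` B ->
  w (fine (P A)) <= w (fine (P B)).
Proof.
move=> hw mA mB AB; apply: weighting_homo_le => //;
  try exact: fine_probability_itv.
by rewrite fine_le ?fin_num_measure ?le_measure ?inE.
Qed.

Lemma measurable_ge_set (f : T -> R) (t : R) : measurable_fun setT f ->
  measurable [set omega | t <= f omega].
Proof.
move=> mf; rewrite -[X in measurable X]setTI.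
by apply: measurable_fun_le.
Qed.

Lemma measurable_le_set (f : T -> R) (t : R) : measurable_fun setT f ->
  measurable [set omega | f omega <= t].
Proof.
move=> mf; rewrite -[X in measurable X]setTI.
by apply: measurable_fun_le.
Qed.

(** Raising [zeta] enlarges each event [t <= v (zeta omega)], hence raises the integrand at every
    [t]. *)
Lemma le_gain_part w v zeta zeta' : @weighting_functions R w ->
  @value_functions R v ->
  measurable_fun setT zeta -> measurable_fun setT zeta' ->
  (forall omega, zeta omega <= zeta' omega) ->
  (gain_part P w v zeta <= gain_part P w v zeta')%E.
Proof.
move=> hw hv mz mz' zz'.
have mvz := measurable_value_comp hv.
(* The upper-tail event shrinks as [t] grows, so the integrand is monotone in [t] and therefore
   Borel. *)
have mP (f : T -> R) : measurable_fun setT f ->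
    measurable_fun (`[0, +oo[ : set R)
      (fun t => (w (fine (P [set omega | t <= v (f omega)])))%:E).
  move=> mf; apply/measurable_EFinP; apply: nonincreasing_measurable => //.
  move=> s t st /=; apply: weighted_probability_le => //;
    try exact: (measurable_ge_set _ (mvz _ mf)).
  by move=> omega /=; exact: le_trans.
apply: ge0_le_integral => //; [|exact: mP|exact: mP|] => t _.
  rewrite lee_fin weighted_probability_ge0//.
  exact: (measurable_ge_set _ (mvz _ mz)).
rewrite lee_fin; apply: weighted_probability_le => //.
- exact: (measurable_ge_set _ (mvz _ mz)).
- exact: (measurable_ge_set _ (mvz _ mz')).
- by move=> omega /= /le_trans; apply; exact: value_homo_le.
Qed.

(** Mirror image of the gain part: raising [zeta] shrinks the lower-tail events, whose weights are
    nondecreasing in [t]. *)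
Lemma ge_loss_part w v zeta zeta' : @weighting_functions R w ->
  @value_functions R v ->
  measurable_fun setT zeta -> measurable_fun setT zeta' ->
  (forall omega, zeta omega <= zeta' omega) ->
  (loss_part P w v zeta' <= loss_part P w v zeta)%E.
Proof.
move=> hw hv mz mz' zz'.
have mvz := measurable_value_comp hv.
have mP (f : T -> R) : measurable_fun setT f ->
    measurable_fun (`]-oo, 0] : set R)
      (fun t => (w (fine (P [set omega | v (f omega) <= t])))%:E).
  move=> mf; apply/measurable_EFinP; apply: nondecreasing_measurable => //.
  move=> s t st /=; apply: weighted_probability_le => //;
    try exact: (measurable_le_set _ (mvz _ mf)).
  by move=> omega /= /le_trans; exact.
apply: ge0_le_integral => //; [|exact: mP|exact: mP|] => t _.
  rewrite lee_fin weighted_probability_ge0//.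
  exact: (measurable_le_set _ (mvz _ mz')).
rewrite lee_fin; apply: weighted_probability_le => //.
- exact: (measurable_le_set _ (mvz _ mz')).
- exact: (measurable_le_set _ (mvz _ mz)).
- by move=> omega /=; apply: le_trans; exact: value_homo_le.
Qed.

(** The loss part enters with a minus sign, so both parts push the same way; subtraction in [\bar R]
    is monotone at infinite values too. *)
Lemma le_weighted_expectation v wm wp zeta zeta' :
  @value_functions R v -> @weighting_functions R wm ->
  @weighting_functions R wp ->
  measurable_fun setT zeta -> measurable_fun setT zeta' ->
  (forall omega, zeta omega <= zeta' omega) ->
  (weighted_expectation P (v, wm, wp) zeta <=
   weighted_expectation P (v, wm, wp) zeta')%E.
Proof.
by move=> hv hwm hwp *; apply: leeB; [exact: le_gain_part|exact: ge_loss_part].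
Qed.

End Monotonicity.

Theorem proposition2p1 (d : measure_display) (T : measurableType d)
  (R : realType) (P : probability T R) (V W : set (R -> R))
  (xi : {RV P >-> R})
  (hV : V `<=` @value_functions R)
  (hW : W `<=` @weighting_functions R)
  (hdef : forall x : R,
     sup_weighted_expectation_defined P V W (xi \- cst x)) :
  robust_shortfall P V W xi = sup_shortfall P V W xi.
Proof.
pose A (theta : (R -> R) * (R -> R) * (R -> R)) : set R :=
  [set x | (weighted_expectation P theta (xi \- cst x)%R <= 0)%E].
(* A supremum is at most 0 exactly when all its members are. *)
have -> : robust_shortfall P V W xi =
    ereal_inf [set x%:E | x in \bigcap_(theta in V `*` W `*` W) A theta].
  congr (ereal_inf (image _ _)); apply/seteqP; split => x /=.
    by move=> /ereal_supP sup_le theta VWW; apply: sup_le; exists theta.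
  by move=> le0; apply/ereal_supP => _ [theta VWW <-]; exact: le0.
apply: ereal_inf_bigcap_up => -[[v wm] wp] [[/= Vv Wm] Wp] x y xy.
(* Up-closure of [A theta]: for [x <= y], [xi - y] lies pointwise below [xi - x]. *)
apply: le_trans; apply: le_weighted_expectation;
  [exact: hV|exact: hW|exact: hW| | |].
- exact: measurable_funB.
- exact: measurable_funB.
- by move=> omega /=; rewrite lerB.
Qed.
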